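(* Let $U$, $W_*$, $X$ be normed spaces, $W=(W_* )^*$, $G:U\times X\rightrightarrows W_*$, $J:U\to\mathbb{R}$ continuously differentiable, $R:X\to(-\infty,\infty]$, and let $S:X\rightrightarrows U$, $S(x)=\{u\in U\mid 0\in G(u,x)\}$; $\mathrm{Sup}_{J\circ S}$ is regarded as a function $X\to(-\infty,\infty]$ (that is, $S$ has nonempty values). Let $\bar x\in X$, $\bar u\in U$ and $\bar x^*\in X^*$. Then the pessimistic necessary optimality condition $0\in\partial_F[\mathrm{Sup}_{J\circ S}+R](\bar x)$ holds if $S$ is inner Lipschitz at $\bar x$ relative to $\{\bar u\}$ and $$(-J'(\bar u),\bar x^* )\in\mathrm{ran}\,\widehat D^*G(\bar u,\bar x|0)\quad\text{with}\quad0\in\bar x^*+\partial_F R(\bar x)\quad\text{and}\quad\bar u\in S^\flat(\bar x).$$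
   Context: $\mathrm{Sup}_{J\circ S}(x)=\sup\{J(u)\mid u\in S(x)\}$ and $S^\flat(x)=\{u\in S(x)\mid J(u)=\mathrm{Sup}_{J\circ S}(x)\}$. Fréchet subdifferential of $F:X\to(-\infty,\infty]$ at $x$ with $F(x)$ finite (empty if $F(x)=\infty$): $\partial_F F(x)=\{x^*\in X^*\mid \liminf_{\tilde x\to x}\frac{F(\tilde x)-F(x)-\langle x^*|\tilde x-x\rangle}{\|\tilde x-x\|}\ge 0\}$. Fréchet coderivative of $F:X\rightrightarrows Y$ at $x$ for $y$: for $y^*\in Y^*$, $$\widehat D^*F(x|y)(y^* )=\Bigl\{x^*\in X^*\Bigm| \limsup_{\tilde x\to x,\ F(\tilde x)\ni\tilde y\to y}\frac{\langle x^*|\tilde x-x\rangle-\langle y^*|\tilde y-y\rangle}{\|\tilde x-x\|+\|\tilde y-y\|}\le 0\Bigr\}.$$ In particular $\widehat D^*G(\bar u,\bar x|0):W\rightrightarrows U^*\times X^*$, and $\mathrm{ran}$ denotes the range, i.e. the union of all values. $F:X\rightrightarrows Y$ is inner Lipschitz at $x$ relative to $A\subset Y$ if for every $y\in A$ there exist $\lambda_y\ge0$ and $\rho_y>0$ with $\inf_{z\in F(\tilde x)}\|z-y\|\le\lambda_y\|x-\tilde x\|$ for all $\tilde x\in B(x,\rho_y)$ with $F(\tilde x)\neq\emptyset$. *)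

(* Defs.v *)
From HB Require Import structures.
From mathcomp Require Import all_boot all_order all_algebra.
From mathcomp Require Import all_classical all_reals all_analysis.

Set Implicit Arguments.
Unset Strict Implicit.
Unset Printing Implicit Defensive.
Import Order.TTheory GRing.Theory Num.Theory.
Import numFieldNormedType.Exports.

Local Open Scope classical_set_scope.
Local Open Scope ring_scope.

Section dual.
Context {K : realType} (X : normedModType K).

Definition is_dual : {pred X -> K} :=
  [pred f : X -> K | `[< linear f /\ continuous f >]].

Lemma is_dualP (f : X -> K) :
  reflect (linear f /\ continuous f) (f \in is_dual).
Proof. exact: asboolP. Qed.

Fact is_dual_submod_closed : submod_closed is_dual.
Proof.
split=> [|a f g /is_dualP[lf cf] /is_dualP[lg cg]]; apply/is_dualP; split.
- by move=> a x y; rewrite /= scaler0 addr0.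
- exact: cst_continuous.
- move=> b x y; rewrite /= [LHS](_ : _ = a *: f (b *: x + y) + g (b *: x + y))//.
  rewrite [RHS](_ : _ = b *: (a *: f x + g x) + (a *: f y + g y))//.
  by rewrite lf lg !scalerDr !scalerA (mulrC a b) addrACA.
- move=> x; apply: (@cvgD _ _ _ (nbhs x)); last exact: cg.
  by apply: cvgZr; exact: cf.
Qed.

HB.instance Definition _ :=
  GRing.isSubmodClosed.Build K (X -> K) is_dual is_dual_submod_closed.

Record dual : Type := Dual {
  dual_fun :> X -> K ;
  _ : dual_fun \in is_dual }.

HB.instance Definition _ := [isSub for dual_fun].
HB.instance Definition _ := [Choice of dual by <:].
HB.instance Definition _ := [SubChoice_isSubLmodule of dual by <:].

Lemma dual_linear (f : dual) : linear f.
Proof. by have /is_dualP[] := valP f. Qed.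

HB.instance Definition _ (f : dual) :=
  GRing.isLinear.Build K X K _ (f : X -> K) (dual_linear f).

Lemma dual_continuous (f : dual) : continuous f.
Proof. by have /is_dualP[] := valP f. Qed.

Lemma dual_eqP (f g : dual) : f =1 g -> f = g.
Proof. by move=> fg; apply/val_inj/funext. Qed.

Lemma dualDE (f g : dual) x : (f + g) x = f x + g x. Proof. by []. Qed.
Lemma dualNE (f : dual) x : (- f) x = - f x. Proof. by []. Qed.
Lemma dualZE a (f : dual) x : (a *: f) x = a * f x. Proof. by []. Qed.
Lemma dual0E x : (0 : dual) x = 0. Proof. by []. Qed.

Definition dual_norm (f : dual) : K := sup [set `|f x| | x in [set x | `|x| <= 1]].

Lemma dual_norm_has_sup (f : dual) :
  has_sup [set `|f x| | x in [set x | `|x| <= 1]].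
Proof.
split; first by exists `|f 0|, 0 => //=; rewrite normr0.
have bf : bounded_near f (nbhs 0).
  by apply: continuous_linear_bounded; exact: dual_continuous.
have [M fM] := (bounded_funP f).2 bf 1.
by exists M => _ [x /= x1 <-]; exact: fM.
Qed.

Lemma dual_norm_ub (f : dual) x : `|x| <= 1 -> `|f x| <= dual_norm f.
Proof.
by move=> x1; apply: sup_upper_bound; [exact: dual_norm_has_sup | exists x].
Qed.

Lemma dual_norm_le (f : dual) c :
  (forall x, `|x| <= 1 -> `|f x| <= c) -> dual_norm f <= c.
Proof.
move=> fc; apply: ge_sup; first exact: (dual_norm_has_sup f).1.
by move=> _ [x /= x1 <-]; exact: fc.
Qed.

Lemma dual_norm_ge0 (f : dual) : 0 <= dual_norm f.
Proof. by apply: (le_trans (normr_ge0 (f 0))); apply: dual_norm_ub; rewrite normr0. Qed.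

Lemma dual_norm_apply (f : dual) x : `|f x| <= dual_norm f * `|x|.
Proof.
have [->|x0] := eqVneq x 0; first by rewrite linear0 !normr0 mulr0.
have nx0 : 0 < `|x| by rewrite normr_gt0.
have := @dual_norm_ub f (`|x|^-1 *: x).
rewrite normrZ normfV normr_id mulVf ?gt_eqF// => /(_ (lexx _)).
by rewrite linearZ/= normrM normfV normr_id mulrC ler_pdivrMr.
Qed.

Fact dual_ler_normD (f g : dual) : dual_norm (f + g) <= dual_norm f + dual_norm g.
Proof.
apply: dual_norm_le => x x1; rewrite dualDE.
by rewrite (le_trans (ler_normD _ _))// lerD// dual_norm_ub.
Qed.

Fact dual_normrZ (a : K) (f : dual) : dual_norm (a *: f) = `|a| * dual_norm f.
Proof.
have le1 b g : dual_norm (b *: g) <= `|b| * dual_norm g.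
  apply: dual_norm_le => x x1.
  by rewrite dualZE normrM ler_wpM2l// dual_norm_ub.
apply/eqP; rewrite eq_le le1 /=.
have [->|a0] := eqVneq a 0; first by rewrite normr0 mul0r dual_norm_ge0.
rewrite -ler_pdivlMl ?normr_gt0// -normfV.
by apply: le_trans (le1 _ _); rewrite scalerA mulVf// scale1r.
Qed.

Fact dual_normr0_eq0 (f : dual) : dual_norm f = 0 -> f = 0.
Proof.
move=> f0; apply: dual_eqP => x; apply/eqP; rewrite dual0E -normr_le0.
by rewrite (le_trans (dual_norm_apply f x))// f0 mul0r.
Qed.

HB.instance Definition _ :=
  @Lmodule_isNormed.Build K dual dual_norm dual_ler_normD dual_normrZ
    dual_normr0_eq0.

Lemma dual_normE (f : dual) : `|f| = dual_norm f. Proof. by []. Qed.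

End dual.

Section dual_pair.
Context {K : realType} {U X : normedModType K}.

Fact dual_pair_subproof (us : dual U) (xs : dual X) :
  (fun z : U * X => us z.1 + xs z.2) \in @is_dual K (U * X)%type.
Proof.
apply/is_dualP; split.
- by move=> a x y /=; rewrite !linearP scalerDr addrACA.
- move=> z; apply: (@cvgD _ _ _ (nbhs z)).
  + by apply: (@continuous_comp _ _ _ fst us); [exact: cvg_fst|exact: dual_continuous].
  + by apply: (@continuous_comp _ _ _ snd xs); [exact: cvg_snd|exact: dual_continuous].
Qed.

(** The identification of U^* x X^* with (U x X)^*, so that the coderivative
    of a map on [U * X] may take its values in the dual of a single space. *)
Definition dual_pair (us : dual U) (xs : dual X) : dual (U * X)%type :=
  Dual (dual_pair_subproof us xs).

End dual_pair.

Section frechet_derivative.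
Context {K : realType} {U : normedModType K}.

(** The library's differential ['d J u] as an element of the dual; the
    fallback value 0 occurs only when [J] is not differentiable at [u]. *)
Definition fderiv (J : U -> K) (u : U) : dual U := insubd 0 ('d J u : U -> K).

Lemma fderivE (J : U -> K) (u : U) : differentiable J u ->
  fderiv J u = 'd J u :> (U -> K).
Proof.
move=> dJ; rewrite /fderiv val_insubd ifT//; apply/is_dualP; split.
  exact: linearP.
exact: diff_continuous.
Qed.

(** [continuous (fderiv J)] refers to the dual norm on [dual U]. *)
Definition continuously_differentiable (J : U -> K) :=
  (forall u, differentiable J u) /\ continuous (fderiv J).

End frechet_derivative.

Section variational_analysis.
Context {K : realType}.
Implicit Types X Y : normedModType K.

(** The denominator vanishes only at [x], which is excluded from [x^']. *)
Definition frechet_subdiff X (F : X -> \bar K) (x : X) : set (dual X) :=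
  [set xs : dual X | F x \is a fin_num /\
    (0 <= limf_einf
      (fun z => (F z - F x - (xs (z - x))%:E) / `|z - x|%:E) x^')%E].

(** Likewise, [(x, y)] itself is excluded; by [within], the limit is taken
    along the graph of [F]. *)
Definition frechet_coderiv X Y (F : X -> set Y) (x : X) (y : Y)
    (ys : dual Y) : set (dual X) :=
  [set xs : dual X |
    (limf_esup (fun z : X * Y =>
       ((xs (z.1 - x) - ys (z.2 - y)) / (`|z.1 - x| + `|z.2 - y|))%:E)
     (within [set z | F z.1 z.2] (x, y)^') <= 0)%E].

Definition ran (A B : Type) (F : A -> set B) : set B := \bigcup_a F a.

Definition inner_lipschitz X Y (F : X -> set Y) (x : X) (A : set Y) :=
  forall y, A y -> exists lambda rho : K,
    [/\ 0 <= lambda, 0 < rho &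
      forall x', ball x rho x' -> F x' !=set0 ->
        inf [set `|z - y| | z in F x'] <= lambda * `|x - x'|].

Definition solution_map (U X : Type) (W : normedModType K) (G : U * X -> set W) (x : X) : set U :=
  [set u | G (u, x) 0].

Definition sup_value (U X : Type) (J : U -> K) (S : X -> set U) (x : X) : \bar K :=
  ereal_sup [set (J u)%:E | u in S x].

Definition sup_argmax (U X : Type) (J : U -> K) (S : X -> set U) (x : X) : set U :=
  [set u | S x u /\ (J u)%:E = sup_value J S x].

End variational_analysis.

(* Main.v *)
(** Membership of [xs] in a Fréchet subdifferential is a first-order lower
    bound up to [e * `|z - x|].  For [z] near [xbar], inner Lipschitz continuity
    provides [u] feasible at [z] with [`|u - ubar| <= L * `|z - xbar|].  As
    [((u, z), 0)] lies on the graph of [G], the coderivative condition bounds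
    [J'(ubar) (u - ubar)] below by [xs (z - xbar)] up to a small multiple of
    [`|z - xbar|], and the optimal value at [z] is at least [J u].  Hence [xs]
    is a subgradient of the optimal value, and the sum rule concludes. *)
Require Import Defs.
From HB Require Import structures.
From mathcomp Require Import all_boot all_order all_algebra.
From mathcomp Require Import all_classical all_reals all_analysis.
From mathcomp Require Import ring lra.
Import Order.TTheory GRing.Theory Num.Theory.
Import numFieldNormedType.Exports.
Local Open Scope classical_set_scope.
Local Open Scope ring_scope.

Set Implicit Arguments.
Unset Strict Implicit.

(** The upper limit is an infimum, over the members of [F], of suprema: if it is strictly below [e],
    so is one of these suprema. Conversely, the sublevel set at [e] is a member whose supremum is at
    most [e]. *)
Lemma limf_esup_le0P (K : realType) (X : topologicalType) (F : set_system X)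
    (f : X -> \bar K) : Filter F ->
  (limf_esup f F <= 0)%E <->
  forall e : K, 0 < e -> \forall x \near F, (f x <= e%:E)%E.
Proof.
move=> FF; split=> [fle e e0|fle].
  have /ereal_inf_lt[_ [V FV <-] fVe] : (limf_esup f F < e%:E)%E.
    by rewrite (le_lt_trans fle)// lte_fin.
  apply: filterS FV => x Vx; apply: le_trans (ltW fVe).
  by apply: ereal_sup_ubound; exists x.
apply/lee_addgt0Pr => e e0; rewrite add0e.
apply: ge_ereal_inf; exists (ereal_sup (f @` [set x | (f x <= e%:E)%E])).
  by exists [set x | (f x <= e%:E)%E] => //; exact: fle.
by apply: ge_ereal_sup => _ [x /= fx <-].
Qed.

Lemma limf_einf_ge0P (K : realType) (X : topologicalType) (F : set_system X)
    (f : X -> \bar K) : Filter F ->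
  (0 <= limf_einf f F)%E <->
  forall e : K, 0 < e -> \forall x \near F, ((- e)%:E <= f x)%E.
Proof.
move=> FF; rewrite /limf_einf oppe_ge0 limf_esup_le0P.
by split=> fge e e0; have := fge e e0; apply: filterS => x;
  rewrite EFinN leeNl.
Qed.

(** Clearing the denominator removes the puncture, since at [z = x] both sides equal [F x]. As [F x]
    is finite, it can be moved across even where [F z] is infinite. *)
Lemma frechet_subdiffP (K : realType) (X : normedModType K) (F : X -> \bar K)
    (x : X) (xs : dual X) :
  frechet_subdiff F x xs <-> F x \is a fin_num /\
    forall e : K, 0 < e -> \forall z \near x,
      (F x + (xs (z - x) - e * `|z - x|)%:E <= F z)%E.
Proof.
rewrite /frechet_subdiff /= limf_einf_ge0P.
have step e z : F x \is a fin_num -> z != x ->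
    ((- e)%:E <= (F z - F x - (xs (z - x))%:E) / `|z - x|%:E)%E =
    (F x + (xs (z - x) - e * `|z - x|)%:E <= F z)%E.
  move=> Fx zx; have nzx : 0 < `|z - x| by rewrite normr_gt0 subr_eq0.
  rewrite inver gt_eqF// lee_pdivlMr// leeBrDr// leeBrDr//.
  by rewrite addeC -EFinM -EFinD mulNr [- _ + _]addrC.
split=> -[Fx Fe]; split=> // e /Fe; rewrite near_withinE; last first.
  by apply: filterS => z Fz zx; rewrite step.
apply: filterS => z Fz; have [->|zx] := eqVneq z x.
  by rewrite subrr linear0 normr0 mulr0 subrr adde0.
by rewrite -step//; exact: Fz.
Qed.

Lemma frechet_coderiv_le (K : realType) (X Y : normedModType K)
    (F : X -> set Y) (x : X) (y : Y) (ys : dual Y) (xs : dual X) (e : K) :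
  frechet_coderiv F x y ys xs -> 0 < e ->
  \forall z \near (x, y), F z.1 z.2 ->
    xs (z.1 - x) - ys (z.2 - y) <= e * (`|z.1 - x| + `|z.2 - y|).
Proof.
move=> /limf_esup_le0P H e0; move: (H e e0); rewrite !near_withinE.
apply: filterS => -[a b] /= Hab Fab.
have [[-> ->]|abxy] := eqVneq (a, b) (x, y).
  by rewrite !subrr !linear0 !normr0 !addr0 mulr0.
have := Hab abxy Fab; rewrite lee_fin ler_pdivrMr//.
(* The denominator is positive off the base point: a sum of two norms vanishes only if both do. *)
rewrite lt0r addr_ge0// andbT; apply: contra_neqN abxy => /eqP/eqP.
rewrite paddr_eq0// !normr_eq0 !subr_eq0.
by move=> /andP[/eqP-> /eqP->].
Qed.

Lemma fderiv_le (K : realType) (U : normedModType K) (J : U -> K) (u : U)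
    (e : K) : differentiable J u -> 0 < e ->
  \forall v \near u, `|J v - J u - fderiv J u (v - u)| <= e * `|v - u|.
Proof.
move=> dJ e0; have /eqaddoP/(_ e e0) := diff_locally dJ.
rewrite (near_shift 0 u) subr0 => H.
apply: filterS H => v /=.
by rewrite !fctE addrK opprD addrA fderivE.
Qed.

Lemma frechet_subdiffD (K : realType) (X : normedModType K)
    (F G : X -> \bar K) (x : X) (xs ys : dual X) :
  frechet_subdiff F x xs -> frechet_subdiff G x ys ->
  frechet_subdiff (F \+ G)%E x (xs + ys).
Proof.
move=> /frechet_subdiffP[Fx Fe] /frechet_subdiffP[Gx Ge].
apply/frechet_subdiffP; split=> [|e e0]; first by rewrite fin_numD Fx Gx.
have e2 : 0 < e / 2 by rewrite divr_gt0.
near=> z.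
have -> : (xs + ys) (z - x) - e * `|z - x| =
    (xs (z - x) - e / 2 * `|z - x|) + (ys (z - x) - e / 2 * `|z - x|).
  rewrite dualDE; lra.
rewrite EFinD addeACA leeD//.
  by near: z; exact: Fe.
by near: z; exact: Ge.
Unshelve. all: by end_near. Qed.

(** The infimum need not be attained. For [z != x], raising [l] to [l + 1] makes the bound strict,
    so some point of [F z] satisfies it; at [z = x] the point [y] itself serves. *)
Lemma inner_lipschitz_near (K : realType) (X Y : normedModType K)
    (F : X -> set Y) (x : X) (y : Y) :
  (forall z, F z !=set0) -> F x y -> inner_lipschitz F x [set y] ->
  exists2 L : K, 1 <= L & \forall z \near x,
    exists2 v, F z v & `|v - y| <= L * `|z - x|.
Proof.
move=> F0 Fxy /(_ y erefl)[l [r [l0 r0 lip]]]; exists (l + 1).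
  by rewrite lerDr.
near=> z; have [->|zx] := eqVneq z x.
  by exists y; rewrite ?subrr ?normr0 ?mulr0.
have nzx : 0 < `|z - x| by rewrite normr_gt0 subr_eq0.
have /inf_lt[] : inf [set `|v - y| | v in F z] < (l + 1) * `|z - x|.
- have /le_lt_trans : inf [set `|v - y| | v in F z] <= l * `|x - z|.
    by apply: lip => //; near: z; exact: nbhsx_ballx.
  by apply; rewrite distrC ltr_pM2r// ltrDl.
- by have [v Fv] := F0 z; exists `|v - y|, v.
- by move=> _ [v Fv <-] /ltW vy; exists v.
Unshelve. all: by end_near. Qed.

Lemma sup_value_subdiff (K : realType) (U Wstar X : normedModType K)
    (G : (U * X)%type -> set Wstar) (J : U -> K) (xbar : X) (ubar : U)
    (xs : dual X) :
  differentiable J ubar ->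
  (forall x, solution_map G x !=set0) ->
  inner_lipschitz (solution_map G) xbar [set ubar] ->
  ran (frechet_coderiv G (ubar, xbar) 0) (dual_pair (- fderiv J ubar) xs) ->
  sup_argmax J (solution_map G) xbar ubar ->
  frechet_subdiff (sup_value J (solution_map G)) xbar xs.
Proof.
move=> dJ S0 lip [ws _ coG] [Subar Jubar]; apply/frechet_subdiffP.
rewrite -Jubar; split=> // e e0.
have [L L1 SL] := inner_lipschitz_near S0 Subar lip.
have L0 : 0 < L by rewrite (lt_le_trans _ L1).
(* Linearizing [J] and applying the coderivative condition each cost at most [d * L] times the norm
   of [z - xbar], that is, half of the allowed error. *)
pose d := e / (2 * L).
have d0 : 0 < d by rewrite divr_gt0// mulr_gt0.
have [r /= r0 HJ] := (nbhs_ballP _ _).1 (fderiv_le dJ d0).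
have [s /= s0 HG] := (nbhs_ballP _ _).1 (frechet_coderiv_le coG d0).
near=> z.
have [u Su ule] : exists2 v, solution_map G z v & `|v - ubar| <= L * `|z - xbar|.
  by near: z.
(* With this radius, [L] times the norm of [z - xbar] is below both [r] and [s], which puts [u] and
   then [((u, z), 0)] within reach of [HJ] and [HG]. *)
have : ball xbar (L^-1 * Num.min r s) z.
  near: z; apply: nbhsx_ballx.
  by rewrite mulr_gt0 ?invr_gt0// lt_min r0.
rewrite -ball_normE /= distrC ltr_pdivlMl// lt_min => /andP[zr zs].
have Ju : `|J u - J ubar - fderiv J ubar (u - ubar)| <= d * `|u - ubar|.
  by apply: HJ; rewrite -ball_normE /= distrC (le_lt_trans ule).
(* The product norm is a maximum; because [1 <= L], the Lipschitz bound on [u - ubar] also dominates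
   its second component. *)
have zx : `|z - xbar| <= L * `|z - xbar| by rewrite ler_peMl.
have Gu : - fderiv J ubar (u - ubar) + xs (z - xbar) <= d * (L * `|z - xbar|).
  have /HG/(_ Su) /= : ball ((ubar, xbar), 0 : Wstar) s ((u, z), 0).
    rewrite -ball_normE /= distrC !prod_normE /= subrr normr0 !gt_max s0 andbT.
    by rewrite (le_lt_trans ule)// (le_lt_trans zx).
  (* The value component stays at [0], so the term in [ws] vanishes. *)
  rewrite subrr linear0 normr0 addr0 subr0 => /le_trans; apply.
  by rewrite ler_pM2l// prod_normE /= ge_max ule zx.
have dL : d * (L * `|z - xbar|) = e / 2 * `|z - xbar|.
  by rewrite /d; field; rewrite gt_eqF.
apply: (@le_trans _ _ (J u)%:E); last first.
  by apply: ereal_sup_ubound; exists u.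
rewrite -EFinD lee_fin.
have {Ju} : - (d * (L * `|z - xbar|)) <= J u - J ubar - fderiv J ubar (u - ubar).
  rewrite lerNl (le_trans (ler_norm _))// normrN (le_trans Ju)//.
  by rewrite ler_pM2l.
move: Gu; rewrite dL; lra.
Unshelve. all: by end_near. Qed.

Theorem theorem3p10 (K : realType) (U Wstar X : normedModType K)
  (G : (U * X)%type -> set Wstar) (J : U -> K) (Rf : X -> \bar K)
  (hJ : continuously_differentiable J)
  (hR : forall x, Rf x != -oo%E)
  (hS : forall x, solution_map G x !=set0)
  (xbar : X) (ubar : U) (xsbar : dual X)
  (hlip : inner_lipschitz (solution_map G) xbar [set ubar])
  (hG : ran (frechet_coderiv G (ubar, xbar) 0)
          (dual_pair (- fderiv J ubar) xsbar))
  (hxs : [set xsbar + r | r in frechet_subdiff Rf xbar] 0)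
  (hu : sup_argmax J (solution_map G) xbar ubar) :
  frechet_subdiff (sup_value J (solution_map G) \+ Rf)%E xbar 0.
Proof.
(* The subgradient [0] splits as [xsbar + r], with [xsbar] going to the optimal value and [r] to
   [Rf]. *)
case: hxs => r Rr <-; apply: frechet_subdiffD Rr.
exact: (sup_value_subdiff (hJ.1 ubar) hS hlip hG hu).
Qed.
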